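(* Let $F(x,y)$ be a weakly billiard-like map, and let $(X,Y)$ be the corresponding modified Lazutkin coordinates; write $F$ in the coordinates $(X,Y)$. Let the mapping be defined and the asymptotics $$F:(X,Y)\mapsto\bigl(X+\sqrt Y+O(Y),\ Y+o(Y^{\frac32})\bigr),\quad\text{as } Y\to0,\ \text{uniformly in } X,$$ hold for $(X,Y)\in V_{\Delta,\eta}:=[-\Delta,\Delta]\times[0,\eta]$, $0<\eta<1$. For every $\delta>0$, $\delta<\Delta$, and every $q_0\in V_{\delta,\eta}$ with $Y(q_0)>0$ set $$q_j:=F^j(q_0),\qquad m=m(q_0):=\max\{j\in\mathbb N\ |\ q_i\in V_{\delta,\eta}\text{ for every } i\le j\}.$$ There exist positive non-decreasing functions $\alpha=\alpha(Y)$, $\beta=\beta(Y)$ in small $Y>0$, with $\alpha(Y),\beta(Y)\to0$ as $Y\to0$, such that for every $\widetilde\eta\in(0,\eta)$ small enough and for every $q_0\in V_{\delta,\widetilde\eta}$ with $Y(q_0)>0$ the following statements hold: 1) One has $$\left|\ln\left(\frac{Y(q_j)}{Y(q_0)}\right)\right|<\alpha(Y(q_0))\quad\text{for every } j\le m(q_0).$$ 2) The number $m(q_0)$ is exactly the biggest number $m$ such that $X(q_j)\le\delta$ for every $j\le m$. 3) For every $j=1,\dots,m(q_0)$ one has $$e^{-\beta(Y(q_0))}Y^{\frac12}(q_0)\le X(q_j)-X(q_{j-1})\le e^{\beta(Y(q_0))}Y^{\frac12}(q_0),$$ $$je^{-\beta(Y(q_0))}Y^{\frac12}(q_0)\le X(q_j)-X(q_0)\le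 je^{\beta(Y(q_0))}Y^{\frac12}(q_0).$$
   Context: A weakly billiard-like map is a germ of mapping $F:(\mathbb R\times\mathbb R_{\ge0},(0,0))\to(\mathbb R\times\mathbb R_{\ge0},(0,0))$ preserving the standard area form $dx\wedge dy$, of the form $$F=(f_1,f_2):(x,y)\mapsto\bigl(x+w(x)\sqrt y+O(y),\ y+O(y^{\frac32})\bigr),\quad w(x)>0,$$ for which the $x$-axis is a line of fixed points and such that the variable change $(x,y)\mapsto(x,\phi)$, $y=\phi^2$ (with $\phi=\sqrt y\ge0$), conjugates $F$ with a $C^2$-smooth germ $\widetilde F(x,\phi)$; the asymptotics are uniform in $x$, as $y\to0$. The modified Lazutkin coordinates associated to $F$ are $X(x)=\int_0^xw^{-\frac23}(z)\,dz$, $Y(x,y)=w^{\frac23}(x)\,y$. In these coordinates $F$ takes the form $(X,Y)\mapsto(X+\sqrt Y+O(Y),\,Y+o(Y^{\frac32}))$, as $Y\to0$, uniformly in $X$. For a point $q$, $X(q)$ and $Y(q)$ denote its coordinates, and $V_{\delta,\eta}=[-\delta,\delta]\times[0,\eta]$. The index $j$ in the definition of $m(q_0)$ may be $0$. *)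

(* Defs.v *)
From Stdlib Require Import Reals.
From Coquelicot Require Import Coquelicot.
Open Scope R_scope.

(* A germ of map of the half-plane R x R_{>=0} at the origin is represented by a
   total function [F : R * R -> R * R]; a germ property only constrains the
   values of [F] at the points (x, y) with y >= 0 that are close to (0, 0). *)
Definition half_germ (P : R -> R -> Prop) : Prop :=
  locally_2d (fun x y => 0 <= y -> P x y) 0 0.

(* C^2-smoothness up to the boundary of a half-plane germ: it is the restriction
   of a function of class C^2 on a full neighbourhood of the origin. *)
Definition C2_half_germ (g : R -> R -> R) : Prop :=
  exists G : R -> R -> R,
    locally_2d (fun x phi => ex_diff_n G 2 x phi) 0 0 /\
    half_germ (fun x phi => g x phi = G x phi).

Definition jacobian (F : R * R -> R * R) (x y : R) : R :=
  Derive (fun s => fst (F (s, y))) x * Derive (fun t => snd (F (x, t))) y -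
  Derive (fun t => fst (F (x, t))) y * Derive (fun s => snd (F (s, y))) x.

(* y^(3/2) is written [y * sqrt y], because [Rpower 0 (3 / 2) = 1]. *)
Definition weakly_billiard_like (F : R * R -> R * R) (w : R -> R) : Prop :=
  half_germ (fun x y => 0 <= snd (F (x, y))) /\
  half_germ (fun x y => y = 0 -> F (x, y) = (x, y)) /\
  half_germ (fun x _ => 0 < w x) /\
  (exists C : R, half_germ (fun x y =>
     Rabs (fst (F (x, y)) - (x + w x * sqrt y)) <= C * y)) /\
  (exists C : R, half_germ (fun x y =>
     Rabs (snd (F (x, y)) - y) <= C * (y * sqrt y))) /\
  (* the two components of F in the coordinates (x, phi), y = phi^2 *)
  C2_half_germ (fun x phi => fst (F (x, phi ^ 2))) /\
  C2_half_germ (fun x phi => sqrt (snd (F (x, phi ^ 2)))) /\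
  (* F^*(dx /\ dy) = dx /\ dy; by the previous clauses F is of class C^2 where
     y > 0, while it need not be differentiable on the axis y = 0 *)
  half_germ (fun x y => 0 < y -> jacobian F x y = 1).

Definition lazX (w : R -> R) (q : R * R) : R :=
  RInt (fun z => Rpower (w z) (- (2 / 3))) 0 (fst q).

Definition lazY (w : R -> R) (q : R * R) : R :=
  Rpower (w (fst q)) (2 / 3) * snd q.

(* The coordinates (X, Y) live on ]a, b[ x R_{>=0}, where ]a, b[ is an open
   interval around 0 on which [w] is given.  Continuity of [w], which near 0
   follows from the C^2-smoothness above, makes X(x) a genuine integral. *)
Definition lazutkin_interval (a b : Rbar) (w : R -> R) : Prop :=
  Rbar_lt a 0 /\ Rbar_lt 0 b /\
  forall x : R, Rbar_lt a x -> Rbar_lt x b -> 0 < w x /\ continuous w x.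

Definition in_chart (a b : Rbar) (q : R * R) : Prop :=
  Rbar_lt a (fst q) /\ Rbar_lt (fst q) b /\ 0 <= snd q.

(* The rectangle V_{delta,eta} = [-delta, delta] x [0, eta] of the (X, Y)-plane,
   as a set of points q of the chart. *)
Definition inV (a b : Rbar) (w : R -> R) (delta eta : R) (q : R * R) : Prop :=
  in_chart a b q /\
  - delta <= lazX w q <= delta /\ 0 <= lazY w q <= eta.

(* Every (X, Y) in V_{Delta,eta} is the coordinate pair of a point, and the image
   of that point under F again has coordinates. *)
Definition defined_on_V (a b : Rbar) (w : R -> R) (F : R * R -> R * R)
    (Delta eta : R) : Prop :=
  (forall X Y : R, - Delta <= X <= Delta -> 0 <= Y <= eta ->
     exists q : R * R, in_chart a b q /\ lazX w q = X /\ lazY w q = Y) /\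
  (forall q : R * R, inV a b w Delta eta q -> in_chart a b (F q)).

(* (X, Y) |-> (X + sqrt Y + O(Y), Y + o(Y^(3/2))) on V_{Delta,eta}, as Y -> 0,
   uniformly in X. *)
Definition lazutkin_asymptotics (a b : Rbar) (w : R -> R) (F : R * R -> R * R)
    (Delta eta : R) : Prop :=
  (exists C d : R, 0 < d /\
     forall q : R * R, inV a b w Delta eta q -> lazY w q < d ->
       Rabs (lazX w (F q) - (lazX w q + sqrt (lazY w q))) <= C * lazY w q) /\
  (forall eps : R, 0 < eps -> exists d : R, 0 < d /\
     forall q : R * R, inV a b w Delta eta q -> lazY w q < d ->
       Rabs (lazY w (F q) - lazY w q) <= eps * (lazY w q * sqrt (lazY w q))).

Definition orbit (F : R * R -> R * R) (q0 : R * R) (j : nat) : R * R :=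
  Nat.iter j F q0.

Definition is_max_nat (P : nat -> Prop) (m : nat) : Prop :=
  P m /\ forall k : nat, P k -> (k <= m)%nat.

(* Positive non-decreasing function on ]0, eps[ with limit 0 at 0. *)
Definition small_modulus (eps : R) (alpha : R -> R) : Prop :=
  (forall Y : R, 0 < Y < eps -> 0 < alpha Y) /\
  (forall Y1 Y2 : R, 0 < Y1 -> Y1 <= Y2 -> Y2 < eps -> alpha Y1 <= alpha Y2) /\
  filterlim alpha (at_right 0) (locally 0).

(* Main.v *)
(* Put [o(r)] for the supremum of [|Y(F q) - Y(q)| / Y(q)^(3/2)] over the points
   with [0 < Y(q) <= r]; it tends to 0 with [r].  A step moves X by at least
   [sqrt Y / 2] and changes [ln Y] by [O(o * sqrt Y)], that is, by [O(o)] times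
   the increment of X.  The increments of X add up to at most [2 * delta] before
   the orbit leaves the rectangle, so the total variation of [ln Y] is
   [O(delta * o)], and each increment of X is [sqrt Y(q_0)] up to a factor
   [exp (O(o + sqrt Y(q_0)))].  In particular X increases and Y stays below [eta],
   hence the orbit can leave the rectangle only through its side [X = delta]. *)

Require Import Defs.
From Stdlib Require Import Reals Lra Lia Classical.
From Coquelicot Require Import Coquelicot.
Open Scope R_scope.

(** * Moduli: positive non-decreasing functions with limit zero at zero *)

Lemma filterlim_at_right_0 (f : R -> R) :
  filterlim f (at_right 0) (locally 0) <->
  forall e : R, 0 < e -> exists d : R, 0 < d /\
    forall y : R, 0 < y < d -> Rabs (f y) < e.
Proof.
  split.
  - intros hf e he.
    destruct (proj1 (filterlim_locally f 0) hf (mkposreal e he)) as [d hd].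
    exists d; split; [apply cond_pos | intros y hy].
    assert (hb : ball 0 d y).
    { change (Rabs (y - 0) < d). rewrite Rabs_pos_eq; lra. }
    generalize (hd y hb (proj1 hy)). intro h. change (Rabs (f y - 0) < e) in h.
    now rewrite Rminus_0_r in h.
  - intros hf. apply filterlim_locally. intros [e he].
    destruct (hf e he) as [d [hd h]].
    exists (mkposreal d hd). intros y hb hy.
    change (Rabs (y - 0) < d) in hb. rewrite Rabs_pos_eq in hb by lra.
    change (Rabs (f y - 0) < e). rewrite Rminus_0_r. apply h; lra.
Qed.

Lemma small_modulus_weaken (eps eps' : R) (f : R -> R) :
  eps' <= eps -> small_modulus eps f -> small_modulus eps' f.
Proof.
  intros h [h1 [h2 h3]]. repeat split; [| | exact h3].
  - intros; apply h1; lra.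
  - intros; apply h2; lra.
Qed.

Lemma small_modulus_plus (eps : R) (f g : R -> R) :
  small_modulus eps f -> small_modulus eps g ->
  small_modulus eps (fun y => f y + g y).
Proof.
  intros [f1 [f2 f3]] [g1 [g2 g3]]. repeat split.
  - intros y hy. generalize (f1 y hy) (g1 y hy); lra.
  - intros y y' h0 h1 h2. generalize (f2 y y' h0 h1 h2) (g2 y y' h0 h1 h2); lra.
  - apply filterlim_at_right_0. intros e he.
    destruct (proj1 (filterlim_at_right_0 f) f3 (e / 2)) as [d1 [hd1 k1]]; [lra|].
    destruct (proj1 (filterlim_at_right_0 g) g3 (e / 2)) as [d2 [hd2 k2]]; [lra|].
    exists (Rmin d1 d2). split; [now apply Rmin_pos | intros y [hy hyd]].
    generalize (Rmin_l d1 d2) (Rmin_r d1 d2); intros.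
    generalize (Rabs_triang (f y) (g y)) (k1 y ltac:(lra)) (k2 y ltac:(lra)); lra.
Qed.

Lemma small_modulus_scale (eps c k : R) (f : R -> R) :
  0 < c -> 0 < k -> small_modulus eps f ->
  small_modulus (eps / k) (fun y => c * f (k * y)).
Proof.
  intros hc hk [h1 [h2 h3]].
  assert (hlt : forall y, y < eps / k -> k * y < eps).
  { intros y hy. apply (Rmult_lt_compat_l k) in hy; [|lra].
    replace (k * (eps / k)) with eps in hy by (field; lra). lra. }
  repeat split.
  - intros y [hy hy']. apply Rmult_lt_0_compat; [lra|].
    apply h1; split; [now apply Rmult_lt_0_compat | now apply hlt].
  - intros y y' hy hyy hy'. apply Rmult_le_compat_l; [lra|].
    apply h2; [now apply Rmult_lt_0_compat | apply Rmult_le_compat_l; lra | now apply hlt].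
  - apply filterlim_at_right_0. intros e he.
    destruct (proj1 (filterlim_at_right_0 f) h3 (e / c)) as [d [hd h]].
    { now apply Rdiv_lt_0_compat. }
    exists (d / k). split; [now apply Rdiv_lt_0_compat | intros y [hy hyd]].
    assert (hky : k * y < d).
    { apply (Rmult_lt_compat_l k) in hyd; [|lra].
      replace (k * (d / k)) with d in hyd by (field; lra). lra. }
    rewrite Rabs_mult, (Rabs_pos_eq c) by lra.
    replace e with (c * (e / c)) by (field; lra).
    apply Rmult_lt_compat_l; [lra|].
    apply h; split; [now apply Rmult_lt_0_compat | exact hky].
Qed.

Lemma small_modulus_sqrt (eps : R) : small_modulus eps sqrt.
Proof.
  repeat split.
  - intros y hy; apply sqrt_lt_R0; lra.
  - intros; apply sqrt_le_1; lra.
  - apply filterlim_at_right_0. intros e he. exists (e * e).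
    split; [nra | intros y hy].
    rewrite Rabs_pos_eq by apply sqrt_pos.
    rewrite <- (sqrt_square e) by lra. apply sqrt_lt_1; lra.
Qed.

Lemma small_modulus_bound (eps e : R) (f : R -> R) :
  0 < e -> small_modulus eps f ->
  exists d : R, 0 < d /\ forall y : R, 0 < y < d -> f y <= e.
Proof.
  intros he [_ [_ h]].
  destruct (proj1 (filterlim_at_right_0 f) h e he) as [d [hd k]].
  exists d; split; [exact hd | intros y hy].
  generalize (k y hy) (Rle_abs (f y)); lra.
Qed.

(** Packs a uniform epsilon-delta estimate into one monotone function: [omega y] is [y] plus the
    supremum of [h] over the points of [P] with [r t <= y]. The supremum grows with [y] because the
    set does. *)
Lemma modulus_of_uniform_limit (T : Type) (P : T -> Prop) (r h : T -> R) :
  (forall e : R, 0 < e -> exists d : R, 0 < d /\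
     forall t : T, P t -> r t < d -> h t <= e) ->
  exists (eps : R) (omega : R -> R), 0 < eps /\ small_modulus eps omega /\
    forall t : T, P t -> 0 < r t < eps -> h t <= omega (r t).
Proof.
  intros hlim.
  (* The value 0 is added to the set so that its supremum is nonnegative, and not minus infinity,
     when no point satisfies [r t <= y]. *)
  set (E := fun y z => z = 0 \/ exists t, P t /\ r t <= y /\ z = h t).
  assert (hub : forall y e, 0 <= e -> (forall t, P t -> r t <= y -> h t <= e) ->
     is_finite (Lub_Rbar (E y)) /\ 0 <= real (Lub_Rbar (E y)) <= e).
  { intros y e he hb. destruct (Lub_Rbar_correct (E y)) as [h1 h2].
    generalize (h1 0 (or_introl eq_refl)).
    assert (hle : Rbar_le (Lub_Rbar (E y)) e).
    { apply h2. intros z [-> | [t [ht [hr ->]]]]; [exact he | now apply hb]. }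
    revert hle. destruct (Lub_Rbar (E y)); simpl; intros; easy. }
  destruct (hlim 1 Rlt_0_1) as [eps [heps h1]].
  assert (hfin : forall y, y < eps ->
     is_finite (Lub_Rbar (E y)) /\ 0 <= real (Lub_Rbar (E y)) <= 1).
  { intros y hy. apply hub; [lra|]. intros t ht hr. apply h1; [exact ht | lra]. }
  assert (hle : forall t y, P t -> r t <= y -> y < eps -> h t <= real (Lub_Rbar (E y))).
  { intros t y ht hr hy. destruct (hfin y hy) as [hf _].
    destruct (Lub_Rbar_correct (E y)) as [h2 _].
    assert (hE : E y (h t)) by (right; exists t; auto).
    specialize (h2 _ hE). rewrite <- hf in h2. exact h2. }
  (* The supremum may vanish; the summand [y] makes the modulus strictly positive. *)
  exists eps, (fun y => y + real (Lub_Rbar (E y))).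
  split; [exact heps | split; [repeat split | ]].
  - intros y hy. destruct (hfin y ltac:(lra)); lra.
  - intros y y' hy hyy hy'. apply Rplus_le_compat; [exact hyy|].
    apply hub; [now apply hfin|].
    intros t ht hr. apply hle; [exact ht | lra | exact hy'].
  - apply filterlim_at_right_0. intros e he.
    destruct (hlim (e / 2)) as [d [hd h2]]; [lra|].
    exists (Rmin d (e / 2)). split; [apply Rmin_pos; lra | intros y hy].
    generalize (Rmin_l d (e / 2)) (Rmin_r d (e / 2)); intros.
    destruct (hub y (e / 2)) as [_ hb]; [lra | |].
    { intros t ht hr; apply h2; [exact ht | lra]. }
    rewrite Rabs_pos_eq; lra.
  - intros t ht hr. generalize (hle t (r t) ht ltac:(lra) (proj2 hr)); lra.
Qed.

(** * Estimates for a single step of the map *)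

(** Both sides come from [1 + t <= exp t], taken at [ln r] and at [- ln r]; the factor 2 bounds
    [/ r], since [r >= 1 / 2]. *)
Lemma Rabs_ln_le (r u : R) :
  u <= 1 / 2 -> Rabs (r - 1) <= u -> 0 < r /\ Rabs (ln r) <= 2 * u.
Proof.
  intros hu hr. apply Rabs_le_between in hr.
  assert (hr0 : 0 < r) by lra. split; [exact hr0|].
  assert (h1 : ln r <= r - 1).
  { generalize (exp_ineq1_le (ln r)). rewrite exp_ln by exact hr0. lra. }
  assert (h2 : - ln r <= / r - 1).
  { generalize (exp_ineq1_le (- ln r)).
    rewrite exp_Ropp, exp_ln by exact hr0. lra. }
  assert (h3 : / r - 1 <= 2 * u).
  { apply (Rmult_le_reg_r r); [exact hr0|].
    replace ((/ r - 1) * r) with (1 - r) by (field; lra). nra. }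
  apply Rabs_le; lra.
Qed.

Lemma exp_le_compat (x y : R) : x <= y -> exp x <= exp y.
Proof.
  intros [h | ->]; [left; now apply exp_increasing | apply Rle_refl].
Qed.

(** Since [exp (2 * t) >= 1 + 2 * t], it suffices that [(1 - t) * (1 + 2 * t) >= 1], which is
    [t <= 1 / 2] for positive [t]. *)
Lemma exp_opp_le_1_minus (t : R) : 0 <= t <= 1 / 2 -> exp (- (2 * t)) <= 1 - t.
Proof.
  intros ht. rewrite exp_Ropp.
  generalize (exp_ineq1_le (2 * t)); intro h.
  apply (Rmult_le_reg_r (exp (2 * t))); [apply exp_pos|].
  rewrite Rinv_l by apply Rgt_not_eq, exp_pos. nra.
Qed.

(** The change of [ln Y] is measured by the increment of [X], so that it telescopes along an orbit.
    In the factor 4, one 2 comes from [Rabs_ln_le] and the other from [sqrt Y <= 2 * (X' - X)]. *)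
Lemma step_bounds (C o X Y X' Y' : R) :
  0 < Y -> sqrt Y <= 1 -> 0 <= C -> C * sqrt Y <= 1 / 2 -> 0 <= o <= 1 / 2 ->
  Rabs (X' - (X + sqrt Y)) <= C * Y ->
  Rabs (Y' - Y) <= o * (Y * sqrt Y) ->
  0 < Y' /\ Rabs (ln (Y' / Y)) <= 4 * o * (X' - X) /\
  sqrt Y * exp (- (2 * (C * sqrt Y))) <= X' - X <= sqrt Y * exp (2 * (C * sqrt Y)).
Proof.
  intros hY hs1 hC hCs ho hX hY'.
  assert (hs : 0 < sqrt Y) by now apply sqrt_lt_R0.
  assert (hss : sqrt Y * sqrt Y = Y) by (apply sqrt_sqrt; lra).
  set (s := sqrt Y) in *.
  assert (hr : Rabs (Y' / Y - 1) <= o * s).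
  { replace (Y' / Y - 1) with ((Y' - Y) / Y) by (field; lra).
    unfold Rdiv. rewrite Rabs_mult, (Rabs_pos_eq (/ Y))
      by (apply Rlt_le, Rinv_0_lt_compat; lra).
    apply (Rmult_le_reg_r Y); [exact hY|].
    rewrite Rmult_assoc, Rinv_l by lra. lra. }
  destruct (Rabs_ln_le (Y' / Y) (o * s)) as [hpos hln]; [nra | exact hr |].
  apply Rabs_le_between in hX.
  assert (hCY : C * Y = (C * s) * s) by (rewrite <- hss; ring).
  rewrite hCY in hX.
  assert (hCs0 : 0 <= C * s) by nra.
  assert (hCss : C * s * s <= s / 2) by nra.
  split; [| split; [| split]].
  - replace Y' with (Y' / Y * Y) by (field; lra). now apply Rmult_lt_0_compat.
  - eapply Rle_trans; [exact hln|].
    assert (o * (s / 2) <= o * (X' - X)) by (apply Rmult_le_compat_l; lra). lra.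
  - generalize (exp_opp_le_1_minus (C * s) (conj hCs0 hCs)); nra.
  - generalize (exp_ineq1_le (2 * (C * s))); nra.
Qed.

Lemma sqrt_mult_exp (y l : R) : 0 <= y -> sqrt (y * exp l) = sqrt y * exp (l / 2).
Proof.
  intros hy. rewrite sqrt_mult; [| exact hy | apply Rlt_le, exp_pos].
  f_equal. replace (exp l) with (exp (l / 2) * exp (l / 2)).
  - apply sqrt_square, Rlt_le, exp_pos.
  - rewrite <- exp_plus. f_equal. field.
Qed.

(** * Last indices, and distortion along an orbit *)

Lemma exists_is_max_nat (P : nat -> Prop) (n : nat) :
  P 0%nat -> (forall k : nat, P k -> (k <= n)%nat) -> exists m : nat, is_max_nat P m.
Proof.
  intros h0. revert P h0. induction n as [|n IH]; intros P h0 hb.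
  - exists 0%nat; split; auto.
  - destruct (classic (P (S n))) as [h | h].
    + exists (S n); split; auto.
    + apply IH; [exact h0|]. intros k hk. specialize (hb k hk).
      destruct (Nat.eq_dec k (S n)) as [-> | ]; [contradiction | lia].
Qed.

Lemma is_max_nat_ext (P Q : nat -> Prop) (m : nat) :
  (forall k : nat, P k <-> Q k) -> is_max_nat P m -> is_max_nat Q m.
Proof.
  intros h [h1 h2]. split; [now apply h | intros k hk; now apply h2, h].
Qed.

(* [G] stands for membership of the orbit point in the chart. *)
Lemma orbit_distortion (G : nat -> Prop) (X Y : nat -> R) (C o delta : R) :
  0 <= C -> 0 < delta -> 0 <= o <= 1 / 2 -> 8 * delta * o <= 1 ->
  G 0%nat -> - delta <= X 0%nat -> 0 < Y 0%nat -> 4 * Y 0%nat <= 1 ->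
  2 * C * sqrt (Y 0%nat) <= 1 / 2 ->
  (forall i : nat, G i -> - delta <= X i <= delta -> 0 < Y i <= 4 * Y 0%nat ->
     G (S i) /\ Rabs (X (S i) - (X i + sqrt (Y i))) <= C * Y i /\
     Rabs (Y (S i) - Y i) <= o * (Y i * sqrt (Y i))) ->
  forall j : nat, (forall i : nat, (i < j)%nat -> X i <= delta) ->
    G j /\ 0 < Y j /\ X 0%nat <= X j /\
    Rabs (ln (Y j / Y 0%nat)) <= 4 * o * (X j - X 0%nat) /\
    forall i : nat, (i < j)%nat ->
      sqrt (Y 0%nat) * exp (- (4 * delta * o + 4 * C * sqrt (Y 0%nat)))
        <= X (S i) - X i
        <= sqrt (Y 0%nat) * exp (4 * delta * o + 4 * C * sqrt (Y 0%nat)).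
Proof.
  intros hC hdelta ho hdo hG0 hX0 hY0 hY1 hCs hstep j.
  assert (hs0 : 0 < sqrt (Y 0%nat)) by now apply sqrt_lt_R0.
  induction j as [|j IH]; intros hj.
  - repeat split; auto; try lra; try lia.
    replace (Y 0%nat / Y 0%nat) with 1 by (field; lra).
    rewrite ln_1, Rabs_R0. lra.
  - destruct IH as [hG [hY [hX [hln hinc]]]]; [intros i hi; apply hj; lia|].
    assert (hXj : X j <= delta) by (apply hj; lia).
    set (l := ln (Y j / Y 0%nat)) in *.
    assert (hYj : Y j = Y 0%nat * exp l).
    { unfold l. rewrite exp_ln by (now apply Rdiv_lt_0_compat). field. lra. }
    (* The points 0 and [j] both lie in the strip, so [X j - X 0 <= 2 * delta]. The exponent is thus
       at most 1 in absolute value and [Y j <= 3 * Y 0], which keeps the orbit in the range where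
       [hstep] applies. *)
    assert (hl : - (8 * delta * o) <= l <= 8 * delta * o).
    { apply Rabs_le_between. eapply Rle_trans; [exact hln|]. nra. }
    assert (hYle : Y j <= 4 * Y 0%nat).
    { assert (exp l <= 3).
      { apply Rle_trans with (exp 1); [apply exp_le_compat; lra | apply exp_le_3]. }
      rewrite hYj. nra. }
    assert (hsj : sqrt (Y j) = sqrt (Y 0%nat) * exp (l / 2)).
    { rewrite hYj. apply sqrt_mult_exp. lra. }
    assert (hsj2 : sqrt (Y j) <= 2 * sqrt (Y 0%nat)).
    { replace 2 with (sqrt (2 * 2)) by (apply sqrt_square; lra).
      rewrite <- sqrt_mult by lra. apply sqrt_le_1; lra. }
    assert (hsj1 : sqrt (Y j) <= 1).
    { rewrite <- sqrt_1. apply sqrt_le_1; lra. }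
    destruct (hstep j hG ltac:(lra) ltac:(lra)) as [hG' [hX' hY']].
    assert (hCsj : 0 <= C * sqrt (Y j) <= 2 * C * sqrt (Y 0%nat)).
    { generalize (sqrt_pos (Y j)); split; nra. }
    destruct (step_bounds C o (X j) (Y j) (X (S j)) (Y (S j)))
      as [hpos [hln' [hlo hhi]]]; auto; [lra|].
    assert (hmono : 0 <= X (S j) - X j).
    { eapply Rle_trans; [|exact hlo].
      apply Rmult_le_pos; [apply sqrt_pos | apply Rlt_le, exp_pos]. }
    split; [exact hG' | split; [exact hpos | split; [lra | split]]].
    + replace (Y (S j) / Y 0%nat) with ((Y (S j) / Y j) * (Y j / Y 0%nat))
        by (field; lra).
      rewrite ln_mult by now apply Rdiv_lt_0_compat.
      eapply Rle_trans; [apply Rabs_triang|]. fold l. lra.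
    + intros i hi. destruct (Nat.eq_dec i j) as [-> | hij]; [|apply hinc; lia].
      (* The distortion of [sqrt (Y j)] contributes [l / 2], at most [4 * delta * o] in size, and
         the step itself [2 * C * sqrt (Y j) <= 4 * C * sqrt (Y 0)]. The last rewriting restores
         [sqrt (Y j)] inside the exponent. *)
      rewrite hsj, Rmult_assoc, <- exp_plus, <- hsj in hlo, hhi.
      split.
      * eapply Rle_trans; [|exact hlo]. apply Rmult_le_compat_l; [lra|].
        apply exp_le_compat. lra.
      * eapply Rle_trans; [exact hhi|]. apply Rmult_le_compat_l; [lra|].
        apply exp_le_compat. lra.
Qed.

Lemma sum_increments (X : nat -> R) (lo hi : R) (j : nat) :
  (forall i : nat, (i < j)%nat -> lo <= X (S i) - X i <= hi) ->
  INR j * lo <= X j - X 0%nat <= INR j * hi.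
Proof.
  induction j as [|j IH]; intros h.
  - simpl; lra.
  - rewrite S_INR. generalize (h j ltac:(lia)) (IH ltac:(intros; apply h; lia)). lra.
Qed.

(** * Choice of the moduli and proof of the three statements *)

Theorem lemma7p13 (F : R * R -> R * R) (w : R -> R) (a b : Rbar) (Delta eta : R)
  (hF : weakly_billiard_like F w)
  (hw : lazutkin_interval a b w)
  (heta : 0 < eta < 1)
  (hdef : defined_on_V a b w F Delta eta)
  (hasym : lazutkin_asymptotics a b w F Delta eta) :
  forall delta : R, 0 < delta -> delta < Delta ->
  exists (eps : R) (alpha beta : R -> R),
    0 < eps /\ small_modulus eps alpha /\ small_modulus eps beta /\
    forall eta' : R, 0 < eta' < eta -> eta' < eps ->
    forall q0 : R * R, inV a b w delta eta' q0 -> 0 < lazY w q0 ->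
    let q := orbit F q0 in
    let X := fun j : nat => lazX w (q j) in
    let Y := fun j : nat => lazY w (q j) in
    exists m : nat,
      is_max_nat (fun j => forall i : nat, (i <= j)%nat ->
                             inV a b w delta eta (q i)) m /\
      (forall j : nat, (j <= m)%nat ->
         0 < Y j /\ Rabs (ln (Y j / Y 0%nat)) < alpha (Y 0%nat)) /\
      is_max_nat (fun k => forall j : nat, (j <= k)%nat -> X j <= delta) m /\
      (forall j : nat, (1 <= j <= m)%nat ->
         (exp (- beta (Y 0%nat)) * sqrt (Y 0%nat) <= X j - X (j - 1)%nat
            <= exp (beta (Y 0%nat)) * sqrt (Y 0%nat)) /\
         (INR j * exp (- beta (Y 0%nat)) * sqrt (Y 0%nat) <= X j - X 0%nat
            <= INR j * exp (beta (Y 0%nat)) * sqrt (Y 0%nat))).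
Proof.
  intros delta hdelta hDelta.
  destruct hdef as [_ hchart]. destruct hasym as [[C0 [dC [hdC hasX]]] hasY].
  (* [C0] may have any sign, while [/ (4 * C)] below must be positive. *)
  set (C := Rmax C0 1).
  assert (hC : 1 <= C) by apply Rmax_r.
  destruct (modulus_of_uniform_limit (R * R)
    (fun q => inV a b w Delta eta q /\ 0 < lazY w q) (lazY w)
    (fun q => Rabs (lazY w (F q) - lazY w q) / (lazY w q * sqrt (lazY w q))))
    as [eo [omega [heo [hom hbound]]]].
  { intros e he. destruct (hasY e he) as [d [hd h]].
    exists d; split; [exact hd | intros q [hq hY] hqd].
    assert (hs : 0 < lazY w q * sqrt (lazY w q))
      by (apply Rmult_lt_0_compat; [|apply sqrt_lt_R0]; lra).
    apply (Rmult_le_reg_r (lazY w q * sqrt (lazY w q))); [exact hs|].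
    unfold Rdiv. rewrite Rmult_assoc, Rinv_l by lra. rewrite Rmult_1_r. now apply h. }
  assert (hdpos : 0 < / (8 * delta)) by (apply Rinv_0_lt_compat; lra).
  (* [d1] secures [o <= 1 / 2] and [8 * delta * o <= 1]; [d2] secures
     [2 * C * sqrt (Y 0) <= 1 / 2]. *)
  destruct (small_modulus_bound eo (Rmin (1 / 2) (/ (8 * delta))) omega)
    as [d1 [hd1 homle]]; [apply Rmin_pos; lra | exact hom |].
  destruct (small_modulus_bound 1 (/ (4 * C)) sqrt)
    as [d2 [hd2 hsle]]; [apply Rinv_0_lt_compat; lra | apply small_modulus_sqrt |].
  (* The quarters leave room for [Y j <= 4 * Y 0] along the orbit; [d2] concerns the initial point
     only. Together with [eta < 1], the bound [eta / 4] also gives [4 * Y 0 <= 1]. *)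
  set (eps := Rmin (Rmin (eo / 4) (dC / 4)) (Rmin (Rmin (d1 / 4) d2) (eta / 4))).
  assert (heps : 0 < eps) by (unfold eps; repeat apply Rmin_pos; lra).
  assert (hepsle : eps <= eo / 4 /\ eps <= dC / 4 /\ eps <= d1 / 4 /\ eps <= d2 /\
    eps <= eta / 4).
  { unfold eps. repeat split.
    - eapply Rle_trans; [apply Rmin_l | apply Rmin_l].
    - eapply Rle_trans; [apply Rmin_l | apply Rmin_r].
    - eapply Rle_trans; [apply Rmin_r |].
      eapply Rle_trans; [apply Rmin_l | apply Rmin_l].
    - eapply Rle_trans; [apply Rmin_r |].
      eapply Rle_trans; [apply Rmin_l | apply Rmin_r].
    - eapply Rle_trans; [apply Rmin_r | apply Rmin_r]. }
  assert (hscale : forall c, 0 < c -> small_modulus eps (fun y => c * omega (4 * y))).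
  { intros c hc. apply small_modulus_weaken with (eo / 4); [apply hepsle|].
    apply small_modulus_scale; [exact hc | lra | exact hom]. }
  (* The argument [4 * y] covers all heights reached by the orbit. The distortion bounds have
     coefficients 8 and 4 of [delta * o]; 9 makes the first inequality strict, and 9/2 is its half.
     The form [1 * y] fits [small_modulus_scale]. *)
  exists eps, (fun y => 9 * delta * omega (4 * y)),
    (fun y => 9 / 2 * delta * omega (4 * y) + 4 * C * sqrt (1 * y)).
  split; [exact heps | split; [apply hscale; lra | split]].
  { apply small_modulus_plus; [apply hscale; lra|].
    replace eps with (eps / 1) by field.
    apply small_modulus_scale; [lra | lra | apply small_modulus_sqrt]. }
  intros eta' heta' hetaeps q0 hq0 hY0 q X Y.
  destruct hq0 as [hq0 [[hX0 hX0'] [_ hY0']]].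
  change (- delta <= X 0%nat) in hX0. change (X 0%nat <= delta) in hX0'.
  change (0 < Y 0%nat) in hY0. change (Y 0%nat <= eta') in hY0'.
  cbv beta. rewrite (Rmult_1_l (Y 0%nat)).
  set (o := omega (4 * Y 0%nat)).
  assert (ho : 0 < o) by (apply hom; lra).
  assert (hole : o <= 1 / 2 /\ 8 * delta * o <= 1).
  { assert (h : o <= Rmin (1 / 2) (/ (8 * delta))) by (apply homle; lra).
    generalize (Rmin_l (1 / 2) (/ (8 * delta))) (Rmin_r (1 / 2) (/ (8 * delta))).
    intros h1 h2. split; [lra|].
    replace 1 with (8 * delta * / (8 * delta)) by (field; lra).
    apply Rmult_le_compat_l; lra. }
  assert (hs0 : 0 < sqrt (Y 0%nat)) by now apply sqrt_lt_R0.
  assert (hdist := orbit_distortion (fun i => in_chart a b (q i)) X Y C o delta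
    ltac:(lra) hdelta ltac:(lra) ltac:(lra) hq0 hX0 hY0 ltac:(lra)).
  cbv beta in hdist.
  lapply hdist; clear hdist; [intro hdist |].
  2:{ assert (h : sqrt (Y 0%nat) <= / (4 * C)) by (apply hsle; lra).
      apply (Rmult_le_compat_l (2 * C)) in h; [|lra].
      replace (2 * C * / (4 * C)) with (1 / 2) in h by (field; lra). exact h. }
  lapply hdist; clear hdist; [intro hdist |].
  2:{ intros i hG hXi hYi.
      assert (hV : inV a b w Delta eta (q i)).
      { split; [exact hG | split]; fold (X i); fold (Y i); lra. }
      split; [now apply hchart | split].
      - eapply Rle_trans; [apply (hasX (q i) hV); fold (Y i); lra|].
        apply Rmult_le_compat_r; [fold (Y i); lra | apply Rmax_l].
      - assert (hpos : 0 < Y i * sqrt (Y i))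
          by (apply Rmult_lt_0_compat; [|apply sqrt_lt_R0]; lra).
        assert (h : Rabs (Y (S i) - Y i) / (Y i * sqrt (Y i)) <= o).
        { apply Rle_trans with (omega (Y i)).
          - apply (hbound (q i)); [split; [exact hV|] |]; fold (Y i); lra.
          - apply hom; lra. }
        apply (Rmult_le_compat_r (Y i * sqrt (Y i))) in h; [|lra].
        unfold Rdiv in h. rewrite Rmult_assoc, Rinv_l, Rmult_1_r in h by lra.
        exact h. }
  set (be := 9 / 2 * delta * o + 4 * C * sqrt (Y 0%nat)).
  assert (hbe : 4 * delta * o + 4 * C * sqrt (Y 0%nat) <= be).
  { unfold be. generalize (Rmult_lt_0_compat _ _ hdelta ho). lra. }
  assert (hinc : forall j, (forall i, (i < j)%nat -> X i <= delta) ->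
    forall i, (i < j)%nat ->
    exp (- be) * sqrt (Y 0%nat) <= X (S i) - X i <= exp be * sqrt (Y 0%nat)).
  { intros j hj i hi. destruct (hdist j hj) as [_ [_ [_ [_ h]]]].
    generalize (h i hi)
      (exp_le_compat _ _ hbe)
      (exp_le_compat (- be) (- (4 * delta * o + 4 * C * sqrt (Y 0%nat))) ltac:(lra)).
    intros [h1 h2] h3 h4. split; nra. }
  assert (hlnY : forall j, (forall i, (i <= j)%nat -> X i <= delta) ->
    Rabs (ln (Y j / Y 0%nat)) <= 8 * delta * o).
  { intros j hj. destruct (hdist j) as [_ [_ [_ [h _]]]]; [intros; apply hj; lia|].
    eapply Rle_trans; [exact h|]. generalize (hj j (le_n j)). nra. }
  (* [m] is defined by the condition of statement 2. It exists because [k] steps inside the strip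
     advance [X] by at least [k * exp (- be) * sqrt (Y 0)], and at most [2 * delta] is available. *)
  destruct (exists_is_max_nat (fun k => forall j, (j <= k)%nat -> X j <= delta)
    (Z.to_nat (up (2 * delta / (exp (- be) * sqrt (Y 0%nat)))))) as [m hm].
  { intros j hj. replace j with 0%nat by lia. exact hX0'. }
  { intros k hk.
    assert (hc : 0 < exp (- be) * sqrt (Y 0%nat))
      by (apply Rmult_lt_0_compat; [apply exp_pos | exact hs0]).
    destruct (sum_increments X _ _ k (hinc k ltac:(intros; apply hk; lia))) as [h _].
    assert (hk2 : INR k <= 2 * delta / (exp (- be) * sqrt (Y 0%nat))).
    { apply (Rmult_le_reg_r (exp (- be) * sqrt (Y 0%nat))); [exact hc|].
      unfold Rdiv. rewrite (Rmult_assoc (2 * delta)), Rinv_l by lra.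
      generalize (hk k (le_n k)). lra. }
    destruct (archimed (2 * delta / (exp (- be) * sqrt (Y 0%nat)))) as [hup _].
    assert (hlt : (Z.of_nat k < up (2 * delta / (exp (- be) * sqrt (Y 0%nat))))%Z).
    { apply lt_IZR. rewrite <- INR_IZR_INZ. lra. }
    lia. }
  exists m. split; [| split; [| split; [exact hm |]]].
  - apply (is_max_nat_ext (fun k => forall j, (j <= k)%nat -> X j <= delta));
      [|exact hm].
    intros k. split; [| intros h j hj; apply (h j hj)].
    intros h j hj.
    destruct (hdist j) as [hG [hY [hX _]]]; [intros; apply h; lia|].
    assert (hYj : Y j <= 4 * Y 0%nat).
    { assert (hl := hlnY j ltac:(intros; apply h; lia)).
      apply Rabs_le_between in hl.
      replace (Y j) with (exp (ln (Y j / Y 0%nat)) * Y 0%nat)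
        by (rewrite exp_ln by (now apply Rdiv_lt_0_compat); field; lra).
      generalize (exp_le_compat (ln (Y j / Y 0%nat)) 1 ltac:(lra)) exp_le_3. nra. }
    generalize (h j hj). intro.
    split; [exact hG | split]; fold (X j); fold (Y j); lra.
  - intros j hj. destruct hm as [hm _]. split.
    + apply (hdist j). intros; apply hm; lia.
    + eapply Rle_lt_trans; [apply hlnY; intros; apply hm; lia|].
      generalize (Rmult_lt_0_compat _ _ hdelta ho). lra.
  - intros j hj. destruct hm as [hm _].
    assert (h : forall i, (i < j)%nat -> X i <= delta) by (intros; apply hm; lia).
    split.
      (* The subtraction on [nat] is truncated; [1 <= j] makes this replacement valid. *)
      replace (X j) with (X (S (j - 1))) by (f_equal; lia).
      apply (hinc j h). lia.
    + rewrite !Rmult_assoc. apply (sum_increments X). now apply hinc.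
Qed.
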